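(* For any permutation matrix $A$ of order $n$, if $A$ is not the identity matrix, then there are some generalized cycle matrices $Q_1,Q_2,\dots,Q_r$ of type II (of order $n$) and a diagonal matrix $D_t$ (of order $n$) of rank $t$, such that $$A=Q_1+Q_2+\cdots+Q_r+D_t,$$ where the non-zero elements in $D_t$ are all ones, $\sum_{i=1}^{r}\operatorname{rank}Q_i+t=n$, and $1\le r\le\lfloor n/2\rfloor$; moreover $r$, $Q_i$ ($i=1,2,\dots,r$) and $D_t$ are determined by $A$.
   Context: Let $n$ be a positive integer. A permutation matrix of order $n$ is a square matrix of order $n$ with all entries in $\{0,1\}$ having a unique entry $1$ in every row and every column. A generalized cycle matrix of type II of order $n$ with cycle order $k$ ($2\le k\le n$) is a matrix $C$ of order $n$ with entries in $\{0,1\}$ such that $\operatorname{rank}C=k$, exactly $k$ entries of $C$ are non-zero, $C^k$ is a diagonal matrix of rank $k$, and $C^i$ is non-diagonal for $1\le i<k$. A generalized cycle matrix of type II is one with some cycle order $k$, $2\le k\le n$.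
   Formalization: ''Determined by A'' fails as plain uniqueness: for n = 6 and cycle type (3,2,1), A itself is of type II, so r = 1 and r = 2 both occur. Proved instead: there is a decomposition with the largest possible r, and for that r the Q_i (up to order), t and D_t are unique. *)

(* Defs.v *)
From mathcomp Require Import all_boot all_order all_algebra all_fingroup.

Set Implicit Arguments.
Unset Strict Implicit.
Unset Printing Implicit Defensive.

Import GRing.Theory.
Local Open Scope ring_scope.

Definition zero_one_mx (F : fieldType) (n : nat) (C : 'M[F]_n) : Prop :=
  forall i j, C i j = 0 \/ C i j = 1.

(* These conditions say that C is a permutation of k indices whose order is k.
   That permutation need not be a single k-cycle: on 6 indices, the cycle type
   (3,2,1) also has order 6. *)
Definition gen_cycle_mx2_of (F : fieldType) (n k : nat) (C : 'M[F]_n) : Prop :=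
  [/\ (2 <= k <= n)%N,
      zero_one_mx C,
      \rank C = k /\ #|[set p : 'I_n * 'I_n | C p.1 p.2 != 0]| = k,
      is_diag_mx (C ^+ k) /\ \rank (C ^+ k) = k
    & forall i : nat, (1 <= i < k)%N -> ~~ is_diag_mx (C ^+ i)].

Definition gen_cycle_mx2 (F : fieldType) (n : nat) (C : 'M[F]_n) : Prop :=
  exists k : nat, gen_cycle_mx2_of k C.

Definition cycle_decomposition (F : fieldType) (n : nat) (A : 'M[F]_n)
    (r : nat) (Q : 'I_r -> 'M[F]_n) (t : nat) (D : 'M[F]_n) : Prop :=
  [/\ forall i, gen_cycle_mx2 (Q i),
      [/\ is_diag_mx D, \rank D = t & forall i j, D i j != 0 -> D i j = 1],
      A = \sum_(i < r) Q i + D,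
      (\sum_(i < r) \rank (Q i) + t = n)%N
    & (1 <= r <= n %/ 2)%N].

(* Main.v *)
(* A permutation s is split into the restrictions of s to its cycles of length
   at least 2 and the identity on its fixed points. Conversely, comparing ranks
   with numbers of nonzero entries shows that the summands of any decomposition
   are restrictions of s to disjoint s-stable sets, each of which contains a
   cycle of length at least 2; hence there are at most as many summands as such
   cycles. In case of equality each stable set consists of one cycle of length l
   and of fixed points, so the order of s on it is l; as this order is the
   cardinality of the set, the fixed points are absent. *)
Require Import Defs.
From mathcomp Require Import all_boot all_order all_algebra all_fingroup.

Set Implicit Arguments.
Unset Strict Implicit.
Unset Printing Implicit Defensive.

Import GRing.Theory.
Local Open Scope ring_scope.

(** * Restrictions of a permutation matrix to a set of rows *)

(** [S] need not be stable under [s]: this form can thus describe the summands of an unknown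
    decomposition and, with [s] the identity, the 0-1 diagonal matrices. *)
Definition pperm_mx (F : fieldType) (n : nat) (s : 'S_n) (S : {set 'I_n}) :
    'M[F]_n :=
  \matrix_(x, y) ((x \in S) && (s x == y))%:R.

Lemma pperm_mx_neq0 (F : fieldType) n (s : 'S_n) (S : {set 'I_n}) x y :
  (pperm_mx F s S x y != 0) = (x \in S) && (s x == y).
Proof. by rewrite mxE; case: (_ && _); rewrite ?eqxx ?oner_eq0. Qed.

(** The matrix factors through dimension [#|S|]. Conversely, the matrices of [S] and of its
    complement add up to an invertible one, of rank [n], so neither bound is strict. *)
Lemma mxrank_pperm (F : fieldType) n (s : 'S_n) (S : {set 'I_n}) :
  \rank (pperm_mx F s S) = #|S|.
Proof.
have le_rank T : (\rank (pperm_mx F s T) <= #|T|)%N.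
  pose L : 'M[F]_(n, #|T|) := \matrix_(x, j) (x == enum_val j)%:R.
  pose R : 'M[F]_(#|T|, n) := \matrix_(j, y) (s (enum_val j) == y)%:R.
  suff -> : pperm_mx F s T = L *m R by apply: mulmx_max_rank.
  apply/matrixP=> x y; rewrite !mxE.
  under eq_bigr => j _ do rewrite !mxE.
  rewrite -(big_enum_val (fun z => (x == z)%:R * (s z == y)%:R)) /=.
  have [xT | xT] := boolP (x \in T).
    rewrite (bigD1 x) //= eqxx mul1r big1 ?addr0 // => z /andP[_ /negPf].
    by rewrite eq_sym => ->; rewrite mul0r.
  rewrite big1 // => z zT; case: eqP => [xz | _]; last by rewrite mul0r.
  by rewrite xz zT in xT.
apply/eqP; rewrite eqn_leq le_rank /=.
rewrite -(leq_add2r #|~: S|) cardsC card_ord.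
have rk_sum : \rank (pperm_mx F s S + pperm_mx F s (~: S))%R = n.
  rewrite -[RHS](mxrank_unit (unitmx_perm F s)); congr mxrank.
  apply/matrixP=> x y; rewrite !mxE inE.
  by case: (x \in S); rewrite ?addr0 ?add0r.
by rewrite -[leqLHS]rk_sum (leq_trans (mxrank_add _ _)) ?leq_add2l.
Qed.

Lemma card_supp_pperm (F : fieldType) n (s : 'S_n) (S : {set 'I_n}) :
  #|[set p : 'I_n * 'I_n | pperm_mx F s S p.1 p.2 != 0]| = #|S|.
Proof.
have inj : injective (fun x => (x, s x)) by move=> x y [].
rewrite -(card_imset S inj); apply: eq_card => -[x y].
rewrite inE /= pperm_mx_neq0; apply/andP/imsetP => [[xS /eqP <-] | [z zS [-> ->]]].
  by exists x.
by rewrite zS.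
Qed.

(** A row becomes zero once the iterates of its index leave [S]; for [m = 0] the condition is
    vacuous and the power is the identity. *)
Lemma pperm_mx_exp (F : fieldType) n (s : 'S_n) (S : {set 'I_n}) m :
  pperm_mx F s S ^+ m =
  pperm_mx F (s ^+ m)%g [set x | [forall i : 'I_m, iter i s x \in S]].
Proof.
elim: m => [|m IHm].
  apply/matrixP=> x y; rewrite expr0 !mxE inE expg0 perm1.
  by have -> : [forall i : 'I_0, iter i s x \in S] by apply/forallP => -[].
rewrite exprS {}IHm; apply/matrixP=> x y.
rewrite -mulmxE mxE (bigD1 (s x)) //= big1 => [|z]; last first.
  by rewrite !mxE eq_sym => /negPf->; rewrite andbF mul0r.
rewrite addr0 !mxE !inE eqxx andbT -natrM mulnb expgS permM andbA.
congr ((_ && _)%:R); apply/andP/forallP => [[xS /forallP sxS] i | xS].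
  by case: i => -[|i] // lti; have := sxS (Ordinal (lti : (i < m)%N)); rewrite /= -iterSr.
split; first exact: (xS ord0).
by apply/forallP=> i; have := xS (lift ord0 i); rewrite /= -iterSr.
Qed.

Lemma pperm_mx_exp_closed (F : fieldType) n (s : 'S_n) (S : {set 'I_n}) m :
    (0 < m)%N -> {in S, forall x, s x \in S} ->
  pperm_mx F s S ^+ m = pperm_mx F (s ^+ m)%g S.
Proof.
move=> m_gt0 sS; rewrite pperm_mx_exp; congr pperm_mx.
apply/setP=> x; rewrite inE; apply/forallP/idP => [/(_ (Ordinal m_gt0)) // | xS].
by case=> i _ /=; elim: i => //= i /sS.
Qed.

Lemma is_diag_pperm (F : fieldType) n (s : 'S_n) (S : {set 'I_n}) :
  is_diag_mx (pperm_mx F s S) = [forall x in S, s x == x].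
Proof.
apply/is_diag_mxP/forall_inP => [dS x xS | fixS x y].
  apply/eqP; apply/val_inj/esym/eqP; apply/contraT => /dS /eqP.
  by rewrite -[_ == 0]negbK pperm_mx_neq0 xS eqxx.
move=> nxy; apply/eqP; rewrite -[_ == 0]negbK pperm_mx_neq0.
by apply: contra nxy => /andP[/fixS /eqP-> /eqP->].
Qed.

(** The rank of the [k]-th power counts the [x] for which [x, s x, ...], [k] terms in all, stay in
    [S]. As this rank is [#|S|] and [k >= 2], [S] is stable; the other conditions then say that [s]
    has order [k] on [S]. *)
Lemma gen_cycle_ppermP (F : fieldType) n (s : 'S_n) (S : {set 'I_n}) k :
  gen_cycle_mx2_of k (pperm_mx F s S) <->
  [/\ (2 <= k)%N, #|S| = k,
      {in S, forall x, s x \in S /\ iter k s x = x}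
    & forall i, (1 <= i < k)%N -> exists2 x, x \in S & iter i s x != x].
Proof.
split=> [[/andP[k_gt1 _] _ [rkS _] [dk rkk] ndi] | [k_gt1 cardS sS ndi]].
  rewrite mxrank_pperm in rkS; rewrite pperm_mx_exp mxrank_pperm in rkk.
  set T := [set x | _] in rkk.
  have TS : T = S.
    apply/eqP; rewrite eqEcard rkk rkS leqnn andbT.
    by apply/subsetP=> x; rewrite inE => /forallP/(_ (Ordinal (ltnW k_gt1))).
  have sS x : x \in S -> s x \in S.
    by rewrite -{1}TS inE => /forallP/(_ (Ordinal k_gt1)).
  split=> // [x xS | i /[dup] i_bnd /ndi].
    split; first exact: sS.
    move: dk; rewrite pperm_mx_exp is_diag_pperm -/T TS => /forall_inP/(_ x xS)/eqP.
    by rewrite permX.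
  have [i_gt0 _] := andP i_bnd.
  rewrite pperm_mx_exp_closed // is_diag_pperm negb_forall_in.
  by case/exists_inP=> x xS; rewrite permX; exists x.
have sSS : {in S, forall x, s x \in S} by move=> x /sS[].
have k_gt0 := ltnW k_gt1.
split.
- by rewrite k_gt1 -cardS -[n in (_ <= n)%N]card_ord max_card.
- by move=> x y; rewrite mxE; case: (_ && _); [right | left].
- by rewrite mxrank_pperm card_supp_pperm.
- rewrite pperm_mx_exp_closed // mxrank_pperm is_diag_pperm; split=> //.
  by apply/forall_inP=> x /sS[_]; rewrite permX => ->.
move=> i /[dup] /andP[i_gt0 _] /ndi[x xS nix].
rewrite pperm_mx_exp_closed // is_diag_pperm negb_forall_in.
by apply/exists_inP; exists x => //; rewrite permX.
Qed.

Lemma zero_one_diag_pperm (F : fieldType) n (D : 'M[F]_n) :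
    is_diag_mx D -> (forall i j, D i j != 0 -> D i j = 1) ->
  D = pperm_mx F 1%g [set x | D x x != 0].
Proof.
move=> /is_diag_mxP dD D01; apply/matrixP=> x y; rewrite mxE inE perm1.
have [<- | nxy] := eqVneq x y; last by rewrite andbF dD.
by rewrite andbT; case: (eqVneq (D x x) 0) => [// | /D01].
Qed.

(** * Shape of an arbitrary decomposition *)

(* A has n nonzero entries and the summands at most n altogether, so the
   supports of the summands are disjoint and lie in that of A; no entries
   can cancel, whatever the characteristic. *)
Lemma cycle_decomposition_pperm (F : fieldType) n (s : 'S_n)
    r (Q : 'I_r -> 'M[F]_n) t D :
    cycle_decomposition (perm_mx s) Q t D ->
  exists2 S : 'I_r -> {set 'I_n},
    forall i, Q i = pperm_mx F s (S i)
    & forall i j x, x \in S i -> x \in S j -> i = j.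
Proof.
case=> gQ [dD rkD D01] AE sum_n _.
(* [g p] counts the summands that are nonzero at [p]. Where the permutation matrix has a 1, some
   summand is nonzero, so [a <= g]; both have total [n], hence they agree. *)
pose g p := (\sum_i (Q i p.1 p.2 != 0%R) + (D p.1 p.2 != 0%R))%N.
pose a (p : 'I_n * 'I_n) : nat := s p.1 == p.2.
have le_ag p : (a p <= g p)%N.
  rewrite /a; case: eqP => // sp; rewrite lt0n; apply/eqP => /eqP.
  rewrite addn_eq0 sum_nat_eq0 => /andP[/forallP Q0 D0].
  move/matrixP/(_ p.1 p.2): AE; rewrite !mxE sp eqxx summxE big1 => [|i _].
    by move: D0; rewrite eqb0 negbK add0r => /eqP-> /eqP; rewrite oner_eq0.
  by move: (Q0 i); rewrite eqb0 negbK => /eqP.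
have sum_supp (M : 'M[F]_n) :
    (\sum_p (M p.1 p.2 != 0%R) = #|[set p : 'I_n * 'I_n | M p.1 p.2 != 0%R]|)%N.
  rewrite -sum1_card big_mkcond [RHS]big_mkcond /=.
  by apply: eq_bigr => p _; rewrite inE; case: (_ == _).
have sum_a : (\sum_p a p = n)%N.
  rewrite -[RHS]card_ord -cardsT -(card_supp_pperm F s) -sum_supp.
  by apply: eq_bigr => p _; rewrite pperm_mx_neq0 inE.
have sum_g : (\sum_p g p = n)%N.
  rewrite big_split /= exchange_big /= -[RHS]sum_n; congr (_ + _)%N.
    by apply: eq_bigr => i _; rewrite sum_supp; case: (gQ i) => k [_ _ [-> ->]].
  by rewrite sum_supp -rkD (@zero_one_diag_pperm F n D) // card_supp_pperm mxrank_pperm.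
have eq_ag p : g p = a p.
  have /leqif_sum[_] : forall p, true -> (a p <= g p ?= iff (a p == g p))%N.
    by move=> q _; split.
  by rewrite sum_a sum_g eqxx => /esym/forallP/(_ p)/eqP.
have le_g (x y : 'I_n) (P : pred 'I_r) : (\sum_(i | P i) (Q i x y != 0%R) <= (s x == y))%N.
  have := eq_ag (x, y); rewrite /a /= => <-; rewrite /g /= big_mkcond /=.
  apply: leq_trans (leq_addr _ _); apply: leq_sum => i _; by case: (P i).
(* By [le_g], a single summand has no entry off the graph of [s], and two summands never share a
   position on it. *)
exists (fun i => [set x | Q i x (s x) != 0]) => [i | i j x].
  apply/matrixP=> x y; rewrite mxE inE.
  have [<- | nsxy] := eqVneq (s x) y.
    by rewrite andbT; case: (gQ i) => k [_ /(_ x (s x))[] -> _ _ _]; rewrite ?eqxx ?oner_eq0.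
  have := le_g x y (pred1 i); rewrite big_pred1_eq (negPf nsxy) andbF.
  by rewrite leqn0 eqb0 negbK => /eqP.
rewrite !inE => Qi Qj; apply/eqP; apply: contraT; rewrite eq_sym => nji.
have := le_g x (s x) xpredT.
by rewrite (bigD1 i) //= (bigD1 j) //= Qi Qj eqxx.
Qed.

(** * The decomposition into cycles *)

Definition nontrivial_porbits n (s : 'S_n) : {set {set 'I_n}} :=
  [set X in porbits s | (1 < #|X|)%N].

Lemma mem_porbits_eq (T : finType) (s : {perm T}) X x :
  X \in porbits s -> x \in X -> X = porbit s x.
Proof. by case/imsetP=> y _ -> xX; apply/esym/eqP; rewrite eq_porbit_mem. Qed.

Lemma card_porbit_gt1 (T : finType) (s : {perm T}) x :
  (1 < #|porbit s x|)%N = (s x != x).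
Proof.
apply/idP/idP => [gt1 | nfix].
  have := uniq_traject_porbit s x; case: #|_| gt1 => [|[|k]] //= _.
  by rewrite inE eq_sym; case: eqP.
rewrite (cardD1 x) porbit_id ltnS (cardD1 (s x)) inE /= nfix.
by rewrite -[s x]/((s ^+ 1)%g x) mem_porbit.
Qed.

Lemma nontrivial_porbitsP n (s : 'S_n) x :
  (porbit s x \in nontrivial_porbits s) = (s x != x).
Proof. by rewrite inE card_porbit_gt1 imset_f. Qed.

Lemma gen_cycle_porbit (F : fieldType) n (s : 'S_n) X :
  X \in nontrivial_porbits s -> gen_cycle_mx2_of #|X| (pperm_mx F s X).
Proof.
rewrite inE => /andP[Xs X_gt1]; apply/gen_cycle_ppermP; split=> // [x xX|i].
  rewrite (mem_porbits_eq Xs xX) iter_porbit; split=> //.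
  by rewrite -[s x]/((s ^+ 1)%g x) mem_porbit.
case/imsetP: Xs => x _ -> /andP[i_gt0 i_lt].
exists x; first exact: porbit_id.
have := uniq_traject_porbit s x; case def_k: #|_| i_lt => [|k] //.
case: i i_gt0 => // i _ lt_ik /= /andP[xn _].
by apply: contraNneq xn => sx; apply/trajectP; exists i; rewrite // -iterSr.
Qed.

(** Orbits are disjoint, so only the orbit of [x] can contribute. This serves both the count of
    ranks and the matrix identity. *)
Lemma sum_nontrivial_porbits n (s : 'S_n) (x : 'I_n) :
  (\sum_(X in nontrivial_porbits s) (x \in X) = (s x != x))%N.
Proof.
rewrite -nontrivial_porbitsP; have [xP | xP] := boolP (_ \in _).
  rewrite (bigD1 (porbit s x)) //= porbit_id big1 // => X /andP[].
  rewrite inE => /andP[Xs _] nX; apply/eqP; rewrite eqb0.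
  by apply: contra nX => /(mem_porbits_eq Xs)/eqP.
rewrite big1 // => X XP; apply/eqP; rewrite eqb0; apply: contra xP => xX.
by move: (XP); rewrite inE => /andP[Xs _]; rewrite -(mem_porbits_eq Xs xX).
Qed.

Lemma sum_card_nontrivial_porbits n (s : 'S_n) :
  (\sum_(X in nontrivial_porbits s) #|X| + #|[set x | s x == x]| = n)%N.
Proof.
have cardE (S : {set 'I_n}) : (#|S| = \sum_x (x \in S))%N.
  by rewrite -sum1_card big_mkcond; apply: eq_bigr => x _; case: (_ \in _).
rewrite cardE; under eq_bigr => X _ do rewrite cardE.
rewrite exchange_big -big_split /= -[RHS]card_ord -sum1_card.
apply: eq_bigr => x _; rewrite sum_nontrivial_porbits inE; by case: eqP.
Qed.

Lemma porbits_decomposition (F : fieldType) n (s : 'S_n) :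
    s != 1%g ->
  cycle_decomposition (perm_mx s)
    (fun i : 'I_#|nontrivial_porbits s| => pperm_mx F s (enum_val i))
    #|[set x | s x == x]| (pperm_mx F 1%g [set x | s x == x]).
Proof.
move=> s_neq1; set P := nontrivial_porbits s.
split.
- by move=> i; exists #|enum_val i|; apply/gen_cycle_porbit/enum_valP.
- split; rewrite ?mxrank_pperm //.
    by rewrite is_diag_pperm; apply/forall_inP=> x _; rewrite perm1.
  by move=> x y; rewrite pperm_mx_neq0 mxE => ->.
- apply/matrixP=> x y; rewrite !mxE summxE.
  rewrite -(big_enum_val (fun X : {set 'I_n} => pperm_mx F s X x y)) /=.
  under eq_bigr => X _ do rewrite mxE -mulnb mulnC natrM.
  rewrite -mulr_sumr -natr_sum sum_nontrivial_porbits inE perm1 -natrM -natrD.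
  by have [->|nfix] := eqVneq (s x) x; rewrite ?muln0 ?muln1 ?addn0.
- under eq_bigr => i _ do rewrite mxrank_pperm.
  rewrite -(big_enum_val (fun X : {set 'I_n} => #|X|)) /=.
  exact: sum_card_nontrivial_porbits.
apply/andP; split.
  rewrite lt0n cards_eq0; apply: contra s_neq1 => /eqP P0.
  apply/eqP/permP=> x; rewrite perm1; apply/eqP.
  by rewrite -[_ == _]negbK -nontrivial_porbitsP -/P P0 inE.
(* The cycles are disjoint and have at least two points each, so twice their number is at most
   [n]. *)
rewrite leq_divRL // -[n in (_ <= n)%N](sum_card_nontrivial_porbits s).
apply: leq_trans (leq_addr _ _); rewrite -sum_nat_const.
by apply: leq_sum => X; rewrite inE => /andP[].
Qed.

(** * Comparison of an arbitrary decomposition with the cycles *)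

(* Each support S i contains a nontrivial cycle, the value of f at i. *)
Lemma cycle_decomposition_inj (F : fieldType) n (s : 'S_n)
    r (Q : 'I_r -> 'M[F]_n) t D :
    cycle_decomposition (perm_mx s) Q t D ->
  exists f : 'I_r -> {set 'I_n},
    [/\ injective f, forall i, f i \in nontrivial_porbits s
      & r = #|nontrivial_porbits s| -> forall i, Q i = pperm_mx F s (f i)].
Proof.
move=> dec; have [S QE dis] := cycle_decomposition_pperm dec.
have gS i : exists k, gen_cycle_mx2_of k (pperm_mx F s (S i)).
  by case: dec => gQ _ _ _ _; rewrite -QE; apply: gQ.
have closed i x : x \in S i -> porbit s x \subset S i.
  case: (gS i) => k /gen_cycle_ppermP[_ _ sS _] xS.
  apply/subsetP=> _ /porbitP[m ->]; rewrite permX.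
  by elim: m => //= m /sS[].
(* As the order [k] is at least 2, the first power of [s] already moves a point of [S i]. *)
have /fin_all_exists[c cP] i : exists x, (x \in S i) && (s x != x).
  case: (gS i) => k /gen_cycle_ppermP[k_gt1 _ _ /(_ 1%N)[//|x xS nfix]].
  by exists x; rewrite xS.
pose f i := porbit s (c i).
have cS i : c i \in S i by case/andP: (cP i).
have fP i : f i \in nontrivial_porbits s.
  by rewrite nontrivial_porbitsP; case/andP: (cP i).
have f_inj : injective f.
  move=> i j eq_f; apply: (dis i j (c j)) => //.
  by apply: (subsetP (closed i _ (cS i))); rewrite -/(f i) eq_f porbit_id.
exists f; split=> // rE i; rewrite QE; congr pperm_mx.
have f_onto X : X \in nontrivial_porbits s -> exists j, X = f j.
  have : f @: 'I_r \subset nontrivial_porbits s by apply/subsetP=> _ /imsetP[j _ ->]; apply: fP.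
  move/subset_cardP; rewrite (card_imset _ f_inj) card_ord => /(_ rE) <-.
  by case/imsetP=> j _ ->; exists j.
(* A moved point of [S i] lies on some cycle [f j], which is contained in [S j]; disjointness gives
   [j = i]. *)
have S_fix x : x \in S i -> x \notin f i -> s x = x.
  move=> xS; apply: contraNeq; rewrite -nontrivial_porbitsP => /f_onto[j xj].
  have xfj : x \in f j by rewrite -xj porbit_id.
  by rewrite (dis i j x xS (subsetP (closed j _ (cS j)) _ xfj)).
(* The power of s of exponent the length of f i is the identity on S i,
   hence the order #|S i| is at most #|f i|. *)
apply/eqP; rewrite eq_sym eqEcard closed //=.
case: (gS i) => k /gen_cycle_ppermP[k_gt1 -> _ ord_k]; rewrite leqNgt.
have f_gt1: (1 < #|f i|)%N by case/setIdP: (fP i).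
apply/negP => lt_fk; case: (ord_k #|f i|) => [|x xS /eqP[]].
  by rewrite ltnW.
have [xf | xf] := boolP (x \in f i).
  by move: xf; rewrite -eq_porbit_mem => /eqP; rewrite -/(f i) => <-; apply: iter_porbit.
by elim: #|_| => //= m ->; apply: S_fix.
Qed.

Unset Implicit Arguments.

(** Uniqueness is stated for the largest [r]: in cycle type (3,2,1) the whole matrix is a
    generalized cycle matrix of order 6, which gives another decomposition with [r = 1] and
    [D = 0]. *)
Theorem theorem1 (F : fieldType) (n : nat) (A : 'M[F]_n)
    (n_gt0 : (0 < n)%N) (A_perm : is_perm_mx A) (A_neq1 : A <> 1%:M) :
  exists (r : nat) (Q : 'I_r -> 'M[F]_n) (t : nat) (D : 'M[F]_n),
    [/\ cycle_decomposition A Q t D,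
        (* r is determined by A: the largest possible number of summands *)
        forall (r' : nat) (Q' : 'I_r' -> 'M[F]_n) (t' : nat) (D' : 'M[F]_n),
          cycle_decomposition A Q' t' D' -> (r' <= r)%N
      & (* the summands are determined by A, up to the order of the Q i *)
        forall (Q' : 'I_r -> 'M[F]_n) (t' : nat) (D' : 'M[F]_n),
          cycle_decomposition A Q' t' D' ->
          [/\ exists s : 'S_r, forall i, Q' i = Q (s i), t' = t & D' = D]].
Proof.
have [s AE] := is_perm_mxP _ A_perm; rewrite {A}AE in A_perm A_neq1 *.
have s_neq1 : s != 1%g by apply/eqP=> s1; rewrite s1 perm_mx1 in A_neq1.
have dec := porbits_decomposition F s_neq1.
do 4!eexists; split; first exact: dec.
  move=> r' Q' t' D' /cycle_decomposition_inj[f [f_inj fP _]].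
  rewrite -[r']card_ord -(card_imset _ f_inj).
  by apply/subset_leq_card/subsetP=> _ /imsetP[i _ ->]; apply: fP.
move=> Q' t' D' dec'.
have [f [f_inj fP QE]] := cycle_decomposition_inj dec'.
(* [g i] is the position of the cycle [f i] in the enumeration used for [Q]; being injective on
   ['I_r], it is the required permutation. *)
have /fin_all_exists[g gP] i : exists j : 'I_#|nontrivial_porbits s|, enum_val j = f i.
  by exists (enum_rank_in (fP i) (f i)); rewrite enum_rankK_in.
have g_inj : injective g by move=> i j eq_g; apply: f_inj; rewrite -!gP eq_g.
have Q'E i : Q' i = pperm_mx F s (enum_val (perm g_inj i)).
  by rewrite QE // permE gP.
(* Both families have the same sum, which cancels from the two expressions of the matrix. *)
have DE : D' = pperm_mx F 1%g [set x | s x == x].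
  case: dec dec' => _ _ AQ _ _ [_ _ AQ' _ _].
  move: AQ'; rewrite {1}AQ (reindex_inj (@perm_inj _ (perm g_inj))) /=.
  by under [in RHS]eq_bigr => i _ do rewrite Q'E; move/addrI.
split=> //; first by exists (perm g_inj).
by case: dec' => _ [_ <- _] _ _ _; rewrite DE mxrank_pperm.
Qed.
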